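(* Let $F,G\in\mathcal{F}$. If $F\in\mathcal{J}$ and $\overline{F}\asymp\overline{G}$, then $G\in\mathcal{J}$.
   Context: Let $\mathcal{F}$ be the set of all distribution functions of nonnegative random variables with unbounded support, and write $\overline{F}=1-F$. For positive functions $f,g$ on $[0,\infty)$, $f\asymp g$ means $0<\liminf_{x\to\infty}f(x)/g(x)\le\limsup_{x\to\infty}f(x)/g(x)<\infty$. The class $\mathcal{J}$ is the set of all $F\in\mathcal{F}$ such that, for $X_1,X_2,\ldots$ i.i.d. with distribution function $F$ and for all $n\ge2$, $$\lim_{K\to\infty}\liminf_{x\to\infty}\frac{\mathbb{P}(\max(X_1,\ldots,X_n)>x-K,\;X_1+\cdots+X_n>x)}{\mathbb{P}(X_1+\cdots+X_n>x)}=1.$$ *)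

(* Defs.v *)
From mathcomp Require Export all_boot all_order all_algebra.
From mathcomp Require Export all_classical all_reals all_analysis.
Export Order.TTheory GRing.Theory Num.Theory.
Export numFieldNormedType.Exports.

Set Implicit Arguments.
Unset Strict Implicit.
Unset Printing Implicit Defensive.

Local Open Scope classical_set_scope.
Local Open Scope ring_scope.

Definition has_cdf d (T : measurableType d) (R : realType)
    (P : probability T R) (X : {RV P >-> R}) (F : R -> R) : Prop :=
  forall x, cdf X x = (F x)%:E.

(* Topological support of the law of X: the points all of whose neighbourhoods
   are charged. *)
Definition law_support d (T : measurableType d) (R : realType)
    (P : probability T R) (X : {RV P >-> R}) : set R :=
  [set x | forall e : R, 0 < e -> (0 < distribution P X (ball x e))%E].

Definition unbounded_cdf (R : realType) (F : R -> R) : Prop :=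
  exists d (T : measurableType d) (P : probability T R) (X : {RV P >-> R}),
    [/\ forall t, 0 <= X t,
        ~ bounded_set (law_support X)
      & has_cdf X F].

Definition tail (R : realType) (F : R -> R) : R -> R := fun x => 1 - F x.

Definition asymp (R : realType) (f g : R -> R) : Prop :=
  (0 < limf_einf (fun x => (f x / g x)%:E) (pinfty_nbhs R))%E /\
  (limf_esup (fun x => (f x / g x)%:E) (pinfty_nbhs R) < +oo)%E.

Definition mutually_independent d (T : measurableType d) (R : realType)
    (P : probability T R) (I : finType) (X : I -> {RV P >-> R}) : Prop :=
  forall (J : {set I}) (A : I -> set R), (forall i, measurable (A i)) ->
    P (\bigcap_(i in [set` J]) (X i @^-1` A i)) =
    (\prod_(i in J) P (X i @^-1` A i))%E.

Definition iid_with_cdf d (T : measurableType d) (R : realType)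
    (P : probability T R) (I : finType) (X : I -> {RV P >-> R})
    (F : R -> R) : Prop :=
  mutually_independent X /\ forall i, has_cdf (X i) F.

(* The maximum is taken in \bar R, where -oo is neutral, so that it is the
   genuine maximum of the X i t as soon as 0 < n. *)
Definition big_jump_ratio d (T : measurableType d) (R : realType)
    (P : probability T R) (n : nat) (X : 'I_n -> {RV P >-> R})
    (K x : R) : R :=
  fine (P [set t | ((x - K)%:E < \big[maxe/-oo]_(i < n) (X i t)%:E)%E /\
                   x < \sum_(i < n) X i t]) /
  fine (P [set t | x < \sum_(i < n) X i t]).

(* For each n only X_1, ..., X_n matter, so the i.i.d. family has length n. The
   ratio depends only on F, n, K and x; hence quantifying over all realisations
   of the family is the same as choosing one. *)
Definition classJ (R : realType) (F : R -> R) : Prop :=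
  unbounded_cdf F /\
  forall n : nat, (2 <= n)%N ->
  forall d (T : measurableType d) (P : probability T R)
         (X : 'I_n -> {RV P >-> R}), iid_with_cdf X F ->
    limf_einf (fun x => (big_jump_ratio X K x)%:E) (pinfty_nbhs R)
      @[K --> pinfty_nbhs R] --> 1%:E.

(* Main.v *)
From HB Require Import structures.
Require Import Defs.
From mathcomp Require Import ring lra.

(** Why the theorem holds.

    The event that there is no big jump, max <= x - K and S_n > x, is not
    monotone in the variables, so tail bounds do not compare it directly for
    two laws.  It is contained in the event that S_n > x and at least two of
    the variables exceed L >= 0, as soon as K >= n L: otherwise all the variables
    but one are at most L, and S_n <= (x - K) + n L <= x
    ([sum_gt_without_big_jump]).  This second event is an up-set of R^n, and
    it characterises the class as well: if F is in J, then for each e > 0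
    some L makes its probability at most e P(S_n > x) for all large x
    ([two_jumps_negligible]).  Indeed, fix K from the definition of J with
    e / 2.  If two variables exceed L, either there is no jump above x - K,
    which costs (e / 2) P(S_n > x), or some X_i > x - K and some other
    X_j > L, which costs at most n^2 tail(x - K) tail(L).  As
    P(S_n > x) >= P(X_1 > x - K, X_2 > K) = tail(x - K) tail(K), the last
    cost is at most n^2 tail(L) / tail(K) times P(S_n > x), and L is chosen
    after K.

    Up-sets transfer from F to G.  Weak tail equivalence gives a constant
    C >= 1 with tail G <= C tail F and tail F <= C tail G everywhere
    ([asymp_dominated]).  Then Q(Y in A) <= C^n P(X in A) for each measurable
    up-set A of R^n, where X and Y are independent families with tails F and
    G ([independent_dominated]): replace the coordinates one at a time, since
    by Fubini only the one-dimensional sections matter, and these are up-sets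
    of R.  Hence the two-jump event for G costs at most C^n e P(S^X_n > x),
    and P(S^X_n > x) <= C^n P(S^Y_n > x) because the event S_n > x is an
    up-set as well.  This gives a ratio of at most C^(2n) e. *)

Set Implicit Arguments.
Unset Strict Implicit.
Unset Printing Implicit Defensive.

Local Open Scope classical_set_scope.
Local Open Scope ring_scope.

(** * Product laws on tuples *)

Definition box (T : Type) (n : nat) (A : 'I_n -> set T) : set (n.-tuple T) :=
  [set s | forall i, A i (tnth s i)].

Lemma measurable_box d (T : measurableType d) (n : nat) (A : 'I_n -> set T) :
  (forall i, measurable (A i)) -> measurable (box A).
Proof.
move=> mA.
have -> : box A = \bigcap_(i in [set: 'I_n]) (@tnth n T ^~ i) @^-1` A i.
  by apply/seteqP; split=> s /= As i; [move=> _; apply: As|apply: As].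
apply: fin_bigcap_measurable => [|i _]; first exact: finite_finset.
by rewrite -[Z in measurable Z]setTI; apply: (measurable_tnth i).
Qed.

(** The boxes are stable under intersection and generate the sigma-algebra of
    the tuples, so this is an instance of the uniqueness of measures. *)
Lemma tuple_measure_unique d (T : measurableType d) (R : realType) (n : nat)
    (p q : probability (n.-tuple T) R) :
    (forall A : 'I_n -> set T, (forall i, measurable (A i)) ->
      p (box A) = q (box A)) ->
  forall B, measurable B -> p B = q B.
Proof.
move=> pq.
pose G := [set B | exists2 A : 'I_n -> set T,
  (forall i, measurable (A i)) & B = box A].
have boxT : G [set: n.-tuple T].
  exists (fun=> setT) => //; by apply/seteqP; split.
apply: (measure_unique G (fun=> setT)) => //.
- apply/seteqP; split.
  + apply: smallest_sub; first exact: smallest_sigma_algebra.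
    apply: (subset_trans _ (@sub_sigma_algebra _ _ _)).
    rewrite -bigcup_seq => /= B [i _ [C mC <-]].
    exists (fun j => if j == i then C else setT) => [j|]; first by case: eqP.
    apply/seteqP; split=> s /=.
      by move=> [_ Cs] j; case: eqP => [->|].
    by move=> /(_ i); rewrite eqxx.
  + apply: smallest_sub; first exact: sigma_algebra_measurable.
    by move=> _ [A mA ->]; exact: measurable_box.
- move=> _ _ [A mA ->] [C mC ->]; exists (fun i => A i `&` C i).
    by move=> i; exact: measurableI.
  by apply/seteqP; split=> s /=; [move=> [As Cs] i; split; [apply: As|apply: Cs]|
    move=> ACs; split=> i; case: (ACs i)].
- by apply/seteqP; split=> // s _; exists 0%N.
- by move=> _ [A mA ->]; exact: pq.
- move=> k /=. by rewrite probability_setT ltry.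
Qed.

Section product_probability.
Context d1 d2 (T1 : measurableType d1) (T2 : measurableType d2) (R : realType).
Context (p : probability T1 R) (q : probability T2 R).

Definition product_probability : set (T1 * T2) -> \bar R := (p \x q)%E.

HB.instance Definition _ := Measure.on product_probability.

Let product_probability_setT : product_probability setT = 1%E.
Proof.
by rewrite /product_probability -setXTT product_measure1E//=
  !probability_setT mule1.
Qed.

HB.instance Definition _ := Measure_isProbability.Build _ _ _
  product_probability product_probability_setT.

End product_probability.

Section prod_law.
Context d (T : measurableType d) (R : realType).

Definition tuple_cons (n : nat) (u : T * n.-tuple T) : n.+1.-tuple T :=
  [tuple of u.1 :: u.2].

Lemma measurable_tuple_cons (n : nat) :
  measurable_fun setT (@tuple_cons n).
Proof. exact: measurable_cons. Qed.

HB.instance Definition _ n :=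
  isMeasurableFun.Build _ _ _ _ (@tuple_cons n) (@measurable_tuple_cons n).

(** The factors may differ from one another: the law of any independent
    family is the product of the laws of its members. *)
Fixpoint prod_law (n : nat) :
    ('I_n -> probability T R) -> probability (n.-tuple T) R :=
  match n with
  | 0 => fun=> \d_([tuple] : 0.-tuple T)
  | n'.+1 => fun p => distribution
      (product_probability (p ord0) (prod_law (fun i => p (lift ord0 i))))
      (@tuple_cons n')
  end.

Lemma prod_lawS (n : nat) (p : 'I_n.+1 -> probability T R) (A : set _) :
  prod_law p A =
  (p ord0 \x prod_law (fun i => p (lift ord0 i)))%E (@tuple_cons n @^-1` A).
Proof. by []. Qed.

Lemma prod_law_box (n : nat) (p : 'I_n -> probability T R)
    (A : 'I_n -> set T) : (forall i, measurable (A i)) ->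
  prod_law p (box A) = (\prod_(i < n) p i (A i))%E.
Proof.
elim: n p A => [|n IH] p A mA.
  by rewrite big_ord0 /= diracE mem_set// => -[].
rewrite prod_lawS.
have -> : @tuple_cons n @^-1` box A =
    A ord0 `*` box (fun i => A (lift ord0 i)).
  apply/seteqP; split=> -[y s] /=.
    move=> As; split; first by have := As ord0; rewrite tnth0.
    by move=> i; have := As (lift ord0 i); rewrite tnthS.
  by move=> [Ay As] i; case: (unliftP ord0 i) => [j|] ->; rewrite ?tnth0// tnthS.
rewrite product_measure1E//; last exact: measurable_box.
rewrite big_ord_recl; congr (_ * _)%E; exact: IH.
Qed.

End prod_law.

(** * Comparison of up-sets *)

Definition up_set_tuple (R : realType) (n : nat) (A : set (n.-tuple R)) : Prop :=
  forall s t, (forall i, tnth s i <= tnth t i) -> A s -> A t.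

(** A proper nonempty up-set U of the line is a ray starting at inf U.  Open
    rays are covered by the hypothesis, and closed ones are decreasing limits
    of open rays.  The line itself is why C must be at least 1. *)
Lemma up_set_dominated (R : realType) (p q : probability R R) (C : R) :
    1 <= C ->
    (forall x : R, q `]x, +oo[%classic <= C%:E * p `]x, +oo[%classic)%E ->
  forall U : set R, measurable U ->
  (forall x y : R, x <= y -> U x -> U y) -> (q U <= C%:E * p U)%E.
Proof.
move=> C1 pq U mU uU.
have C0 : 0 <= C by exact: le_trans C1.
have [->|/set0P [u Uu]] := eqVneq U set0.
  by rewrite !measure0 mule0.
have [->|/setTPn [v Uv]] := eqVneq U setT.
  by rewrite !probability_setT mule1 lee_fin.
have lbU : has_lbound U.
  by exists v => x Ux; rewrite leNgt; apply/negP => xv; apply/Uv/(uU x) => //; exact: ltW.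
have gtU x : inf U < x -> U x.
  move=> /inf_lt -/(_ (ex_intro _ u Uu)) [y Uy yx].
  by apply: (uU y) => //; exact: ltW.
have [Ua|Ua] := pselect (U (inf U)); last first.
  have -> : U = `]inf U, +oo[%classic; last exact: pq.
  apply/seteqP; split=> x /=; rewrite in_itv/= andbT; last exact: gtU.
  exact: inf_lb_strict.
pose V k : set R := `](inf U - k.+1%:R^-1), +oo[%classic.
have mV k : measurable (V k) by exact: measurable_itv.
have UV k : U `<=` V k.
  move=> x Ux; rewrite /V /= in_itv/= andbT ltrBlDr.
  by rewrite (le_lt_trans (ge_inf lbU Ux))// ltrDl invr_gt0.
have VU : \bigcap_k V k = U.
  apply/seteqP; split=> [x Vx|x Ux k _]; last exact: UV.
  apply: uU Ua; apply/ler_addgt0Pr => e e0.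
  have [k ke] : exists k, k.+1%:R^-1 < e.
    have [N _ /(_ N (leqnn _))] := near_infty_natSinv_lt (PosNum e0).
    by exists N.
  have := Vx k Logic.I; rewrite /V /= in_itv/= andbT => Vkx.
  rewrite -lerBlDr; apply: ltW; apply: le_lt_trans Vkx.
  by rewrite lerD2l lerN2 ltW.
have cvgV : (p \o V) k @[k --> \oo] --> p U.
  rewrite -VU; apply: nonincreasing_cvg_mu => //.
  - by apply: (@le_lt_trans _ _ 1%E); [exact: probability_le1|exact: ltry].
  - by rewrite VU.
  - move=> m n mn; apply/subsetPset => x; rewrite /V /= !in_itv/= !andbT.
    by apply: le_lt_trans; rewrite lerD2l lerN2 lef_pV2 ?posrE// ler_nat ltnS.
have fC : C%:E \is a fin_num by [].
apply: (cvge_to_ge (cvgeZl fC cvgV)); apply: nearW => k.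
by apply: le_trans (pq _); apply: le_measure; rewrite ?inE//; exact: UV.
Qed.

Section domination.
Local Open Scope ereal_scope.
Context (R : realType).

(** Induction on the dimension.  The sections of an up-set are up-sets, so
    the last n coordinates are replaced by integrating the induction
    hypothesis over the first one; then the order of integration is exchanged
    and the first coordinate is replaced. *)
Lemma prod_law_dominated (n : nat) (p q : 'I_n -> probability R R)
    (C : R) : (0 <= C)%R ->
    (forall i (U : set R), measurable U ->
      (forall x y : R, (x <= y)%R -> U x -> U y) -> q i U <= C%:E * p i U) ->
  forall A : set (n.-tuple R), measurable A -> up_set_tuple A ->
  prod_law q A <= (C ^+ n)%:E * prod_law p A.
Proof.
move=> C0; elim: n p q => [|n IH] p q pq A mA uA.
  by rewrite expr0 mul1e.
rewrite !prod_lawS.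
set A' := _ @^-1` A.
have mA' : measurable A'.
  by rewrite -[A']setTI; exact: measurable_tuple_cons.
set p' := prod_law (fun i => p (lift ord0 i)).
set q' := prod_law (fun i => q (lift ord0 i)).
have Cn0 : 0 <= (C ^+ n)%:E by rewrite lee_fin exprn_ge0.
apply: (@le_trans _ _ ((C ^+ n)%:E * (q ord0 \x p') A')).
  rewrite /product_measure1 -ge0_integralZl//; last first.
    exact: measurable_fun_xsection.
  apply: ge0_le_integral => //.
  - exact: measurable_fun_xsection.
  - apply: emeasurable_funM => //; exact: measurable_fun_xsection.
  move=> y _ /=; apply: IH => //.
  - by move=> i; exact: pq.
  - exact: measurable_xsection.
  move=> s t st; rewrite /xsection/= !inE; apply: uA => i.
  by case: (unliftP ord0 i) => [j|] ->; rewrite ?tnth0// !tnthS.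
rewrite exprSr EFinM -muleA lee_wpmul2l//.
have swap (m : probability R R) : (m \x p') A' = (m \x^ p') A'.
  apply: (@product_measure_unique _ _ _ _ _ m p' (m \x^ p')) => //.
  by move=> D E mD mE; rewrite /= product_measure2E.
rewrite !swap /product_measure2 -ge0_integralZl//; last first.
  exact: measurable_fun_ysection.
apply: ge0_le_integral => //.
- exact: measurable_fun_ysection.
- apply: emeasurable_funM => //; exact: measurable_fun_ysection.
move=> s _ /=; apply: pq; first exact: measurable_ysection.
move=> x y xy; rewrite /ysection/= !inE; apply: uA => i.
by case: (unliftP ord0 i) => [j|] ->; rewrite ?tnth0// !tnthS.
Qed.

End domination.

(** * Independent families *)

Section joint_law.
Context d (T : measurableType d) (R : realType) (P : probability T R) (n : nat).
Context (X : 'I_n -> {RV P >-> R}).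

Definition joint (t : T) : n.-tuple R := [tuple X i t | i < n].

Lemma measurable_joint : measurable_fun setT joint.
Proof.
apply/measurable_fun_tnthP => i.
rewrite (_ : _ \o _ = X i); first exact: measurable_funP.
by apply/funext => t; rewrite /= tnth_mktuple.
Qed.

HB.instance Definition _ :=
  isMeasurableFun.Build _ _ _ _ joint measurable_joint.

(** Independence is the product formula on boxes, and laws of tuples are
    determined on boxes. *)
Lemma joint_law_independent : mutually_independent X ->
  forall B : set (n.-tuple R), measurable B ->
  P (joint @^-1` B) = prod_law (fun i => distribution P (X i)) B.
Proof.
move=> indX B mB.
apply: (@tuple_measure_unique _ _ _ _ (distribution P joint)) mB => A mA.
rewrite prod_law_box// /distribution /pushforward.
transitivity (P (\bigcap_(i in [set` [set: 'I_n]%SET]) (X i @^-1` A i))).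
  congr (P _); apply/seteqP; split=> t /=.
    by move=> At i _ ; have := At i; rewrite tnth_mktuple.
  by move=> At i; rewrite tnth_mktuple; apply: At; rewrite /= inE.
rewrite indX//; apply: eq_bigl => i; exact: finset.in_setT.
Qed.

End joint_law.

Lemma independent_dominated d (T : measurableType d) d' (T' : measurableType d')
    (R : realType) (P : probability T R) (Q : probability T' R) (n : nat)
    (X : 'I_n -> {RV P >-> R}) (Y : 'I_n -> {RV Q >-> R}) (C : R) :
    mutually_independent X -> mutually_independent Y -> 1 <= C ->
    (forall i x, (Q [set t | (x < Y i t)%R] <= C%:E * P [set t | (x < X i t)%R])%E) ->
  forall A : set (n.-tuple R), measurable A -> up_set_tuple A ->
  (Q (joint Y @^-1` A) <= (C ^+ n)%:E * P (joint X @^-1` A))%E.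
Proof.
move=> iX iY C1 XY A mA uA.
rewrite !joint_law_independent//.
apply: prod_law_dominated => // [|i U mU uU]; first exact: le_trans C1.
apply: up_set_dominated => // x.
have := XY i x; rewrite /distribution /pushforward.
by congr (_ <= _ * _)%E; congr (_ _); apply/seteqP; split=> t /=;
  rewrite in_itv/= andbT.
Qed.

Section iid_copies.
Context d (T : measurableType d) (R : realType) (P : probability T R).
Context (X : {RV P >-> R}) (n : nat).

(** The coordinates of the n-fold power of the original space, rather than of
    the law on the line: the copies inherit the pointwise nonnegativity of
    X, not only an almost sure one. *)
Definition iid_copy (i : 'I_n) (s : n.-tuple T) : R := X (tnth s i).

Lemma measurable_iid_copy i : measurable_fun setT (iid_copy i).
Proof.
apply: (@measurableT_comp _ _ _ _ _ _ X _ (fun s : n.-tuple T => tnth s i)).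
  exact: measurable_funP.
exact: measurable_tnth.
Qed.

HB.instance Definition _ i :=
  isMeasurableFun.Build _ _ _ _ (iid_copy i) (measurable_iid_copy i).

Lemma iid_copyP (F : R -> R) : has_cdf X F ->
  @iid_with_cdf _ _ _ (prod_law (fun _ : 'I_n => P)) _
    (fun i => [the {mfun _ >-> _} of iid_copy i]) F.
Proof.
move=> cdfX.
have lawE (J : {set 'I_n}) (A : 'I_n -> set R) : (forall i, measurable (A i)) ->
    prod_law (fun _ : 'I_n => P) (\bigcap_(i in [set` J]) (iid_copy i @^-1` A i))
    = (\prod_(i in J) P (X @^-1` A i))%E.
  move=> mA; pose B i := if i \in J then X @^-1` A i else setT.
  have mB i : measurable (B i).
    rewrite /B; case: ifP => // _.
    by rewrite -[Z in measurable Z]setTI; exact: measurable_funP.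
  rewrite (_ : \bigcap_(i in _) _ = box B).
    rewrite prod_law_box// [RHS]big_mkcond/=; apply: eq_bigr => i _.
    by rewrite /B; case: ifP => // _; rewrite probability_setT.
  apply/seteqP; split=> s /= sA i.
    by rewrite /B; case: ifP => // iJ; exact: sA.
  by move=> /= iJ; have := sA i; rewrite /B iJ.
have law1 i (A : set R) : measurable A ->
    prod_law (fun _ : 'I_n => P) (iid_copy i @^-1` A) = P (X @^-1` A).
  move=> mA; have := lawE [set i]%SET (fun=> A) (fun=> mA).
  rewrite big_set1 => <-; congr (_ _); apply/seteqP; split=> s /=.
    by move=> As j /=; rewrite inE => /eqP ->.
  by apply; rewrite /= inE.
split=> [J A mA|i x]; last first.
  by rewrite -cdfX /cdf /distribution /pushforward /= law1.
by rewrite /= lawE//; apply: eq_bigr => i _; rewrite law1.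
Qed.

End iid_copies.

Lemma iid_family_exists (R : realType) (F : R -> R) (n : nat) :
  unbounded_cdf F ->
  exists d (T : measurableType d) (P : probability T R)
    (X : 'I_n -> {RV P >-> R}), iid_with_cdf X F /\ forall i t, 0 <= X i t.
Proof.
move=> [d [T [P [X [X0 _ cdfX]]]]].
exists _, (n.-tuple T : measurableType _), (prod_law (fun _ : 'I_n => P)).
exists (fun i => [the {mfun _ >-> _} of iid_copy X i]).
by split=> [|i t]; [exact: iid_copyP|exact: X0].
Qed.

(** * Tails and limits *)

Lemma measurable_RV_gt d (T : measurableType d) (R : realType)
    (P : probability T R) (X : {RV P >-> R}) (x : R) :
  measurable [set t | x < X t].
Proof.
have := measurable_funPT X measurableT _ (measurable_itv `]x, +oo[).
by rewrite setTI set_itvoy.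
Qed.

Lemma prob_gt_tail d (T : measurableType d) (R : realType)
    (P : probability T R) (X : {RV P >-> R}) (F : R -> R) (x : R) :
  has_cdf X F -> P [set t | x < X t] = (tail F x)%:E.
Proof.
move=> cdfX; rewrite /tail EFinB -cdfX -ccdf_1_cdf.
rewrite /ccdf /distribution /pushforward; congr (P _).
by apply/seteqP; split=> t /=; rewrite in_itv/= andbT.
Qed.

Section tail.
Context (R : realType) (F : R -> R) (F_unbounded : unbounded_cdf F).

(** If the tail vanished at x, every point outside [0, x] would have a
    neighbourhood that is not charged, and the support would be bounded. *)
Lemma tail_gt0 x : 0 < tail F x.
Proof.
have [d [T [P [X [X0 suppX cdfX]]]]] := F_unbounded.
rewrite ltNge; apply/negP => tail0; apply: suppX.
have PX0 : P [set t | x < X t] = 0%E.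
  apply/le_anti; rewrite measure_ge0 andbT.
  by apply: (le_trans (y := (tail F x)%:E)); rewrite ?lee_fin// -(prob_gt_tail _ cdfX).
have null (A : set R) : measurable A -> X @^-1` A `<=` [set t | x < X t] ->
    distribution P X A = 0%E.
  move=> mA sA; apply: (subset_measure0 _ _ sA PX0).
    by rewrite -[Z in measurable Z]setTI; exact: measurable_funPT.
  exact: measurable_RV_gt.
exists x; split; [exact: num_real|move=> M xM y /= suppy].
have y0 : 0 <= y.
  rewrite leNgt; apply/negP => y0.
  have := suppy (- y); rewrite oppr_gt0 => /(_ y0); rewrite null ?ltxx//.
    exact: measurable_realfun.measurable_ball.
  move=> t /=; rewrite /ball/= => Xt; exfalso.
  by have := X0 t; move: Xt; rewrite ltr_norml; lra.
have yx : y <= x.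
  rewrite leNgt; apply/negP => xy.
  have := suppy (y - x); rewrite subr_gt0 => /(_ xy); rewrite null ?ltxx//.
    exact: measurable_realfun.measurable_ball.
  by move=> t /=; rewrite /ball/= ltr_norml; lra.
by rewrite ger0_norm// (le_trans yx)// ltW.
Qed.

Lemma tail_le1 x : tail F x <= 1.
Proof.
have [d [T [P [X [_ _ cdfX]]]]] := F_unbounded.
by rewrite lerBlDr lerDl -lee_fin -cdfX cdf_ge0.
Qed.

Lemma tail_nonincreasing x y : x <= y -> tail F y <= tail F x.
Proof.
have [d [T [P [X [_ _ cdfX]]]]] := F_unbounded.
by move=> xy; rewrite lerD2l lerN2 -lee_fin -!cdfX cdf_nondecreasing.
Qed.

Lemma tail_small e : 0 < e -> \forall x \near +oo, tail F x <= e.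
Proof.
move=> e0; have [d [T [P [X [_ _ cdfX]]]]] := F_unbounded.
have cvg0 : (fine \o ccdf X) x @[x --> +oo] --> 0.
  exact: fine_cvg (@cvg_ccdfy0 _ _ _ _ X).
apply: filterS (cvgr_lt _ cvg0 _ e0) => x.
by rewrite /= ccdf_1_cdf cdfX => /ltW.
Qed.

End tail.

(** The liminf and the limsup give both bounds beyond some x0.  Up to x0 both
    tails lie between their positive value at x0 and 1, so a larger constant
    extends the bounds to the whole line. *)
Lemma asymp_dominated (R : realType) (F G : R -> R) :
    unbounded_cdf F -> unbounded_cdf G -> asymp (tail F) (tail G) ->
  exists2 C, 1 <= C & forall x, tail G x <= C * tail F x /\ tail F x <= C * tail G x.
Proof.
move=> uF uG [].
have F0 := tail_gt0 uF; have G0 := tail_gt0 uG.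
rewrite limf_einfE => /ereal_sup_gt [_ [V nV <-] infV].
rewrite limf_esupE => /ereal_inf_lt [_ [W nW <-] supW].
have [c c0 cV] : exists2 c : R, 0 < c & forall x, V x -> c <= tail F x / tail G x.
  have [x Vx] : V !=set0.
    by case: nV => M [_ MV]; exists (M + 1); apply: MV; rewrite ltrDl.
  have infV_le y : V y -> (ereal_inf [set (tail F x / tail G x)%:E | x in V]
      <= (tail F y / tail G y)%:E)%E.
    by move=> Vy; apply: ereal_inf_lbound; exists y.
  have := infV_le x Vx; move: infV infV_le; case: (ereal_inf _) => // c.
  by rewrite lte_fin => c0 le_c _; exists c => // y /le_c; rewrite lee_fin.
have [C CW] : exists C : R, forall x, W x -> tail F x / tail G x <= C.
  have le_supW y : W y -> ((tail F y / tail G y)%:E <=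
      ereal_sup [set (tail F x / tail G x)%:E | x in W])%E.
    by move=> Wy; apply: ereal_sup_ubound; exists y.
  move: supW le_supW; case: (ereal_sup _) => // [C _ le_C|_ le_C].
    by exists C => y /le_C; rewrite lee_fin.
  by exists 0 => y /le_C.
have [x0 [Vx0 Wx0]] : exists x0, (forall x, x0 < x -> V x) /\ (forall x, x0 < x -> W x).
  case: nV nW => M [_ MV] [N [_ NW]]; exists (Num.max M N).
  by split=> x; rewrite gt_max => /andP[? ?]; [exact: MV|exact: NW].
(* Adding up the five constants makes D at least as large as each of them. *)
pose D := 1 + c^-1 + `|C| + (tail F x0)^-1 + (tail G x0)^-1.
have ci : 0 < c^-1 by rewrite invr_gt0.
have Fi : 0 < (tail F x0)^-1 by rewrite invr_gt0.
have Gi : 0 < (tail G x0)^-1 by rewrite invr_gt0.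
have C0 := normr_ge0 C; have CC := ler_norm C.
exists D => [|x]; first by rewrite /D; lra.
have [xx0|xx0] := leP x x0.
  have bnd H H' (uH : unbounded_cdf H) (uH' : unbounded_cdf H') :
      (tail H x0)^-1 <= D -> tail H' x <= D * tail H x.
    move=> HD; apply: (le_trans (tail_le1 uH' x)).
    have H0 := tail_gt0 uH; rewrite -(mulVf (lt0r_neq0 (H0 x0))).
    apply: ler_pM => //; last exact: tail_nonincreasing.
      by rewrite invr_ge0 ltW.
    exact: ltW.
  by split; apply: bnd => //; rewrite /D; lra.
have := cV x (Vx0 x xx0); have := CW x (Wx0 x xx0).
rewrite ler_pdivrMr// ler_pdivlMr// => FG GF; split.
  rewrite -ler_pdivlMl// in GF.
  apply: (le_trans GF); rewrite ler_wpM2r ?ltW//; rewrite /D; lra.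
apply: (le_trans FG); rewrite ler_wpM2r ?ltW//; rewrite /D; lra.
Qed.

(** A form free of extended reals: a function bounded by 1 converges to 1 as
    soon as it is eventually at least 1 - e for each e. *)
Lemma cvg_limf_einf_1 (R : realType) (r : R -> R -> R) :
    (forall K x, r K x <= 1) ->
  (limf_einf (fun x => (r K x)%:E) (pinfty_nbhs R) @[K --> +oo] --> 1%:E) <->
  (forall e, 0 < e -> \forall K \near +oo, \forall x \near +oo, 1 - e <= r K x).
Proof.
move=> r1; split=> [cvg1 e e0|r_near].
  have lt1 : nbhs 1%:E [set y | ((1 - e)%:E < y)%E].
    by apply: open_ereal_gt'; rewrite lte_fin gtrBl.
  have nK : \forall K \near +oo,
      ((1 - e)%:E < limf_einf (fun x => (r K x)%:E) (pinfty_nbhs R))%E.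
    exact: cvg1 _ lt1.
  apply: filterS nK => K; rewrite limf_einfE.
  move=> /ereal_sup_gt [_ [V nV <-] ltV]; apply: filterS nV => x Vx.
  rewrite -lee_fin; apply: (le_trans (ltW ltV)).
  by apply: ereal_inf_lbound; exists x.
have le1 K : (limf_einf (fun x => (r K x)%:E) (pinfty_nbhs R) <= 1)%E.
  rewrite limf_einfE; apply: ub_ereal_sup => _ [V [M [_ MV]] <-].
  apply: (@le_trans _ _ (r K (M + 1))%:E); last by rewrite lee_fin.
  by apply: ereal_inf_lbound; exists (M + 1) => //; apply: MV; rewrite ltrDl.
move=> A nA; have : nbhs (1 : R) (fun y => A y%:E) by exact: nA.
move=> /nbhs_ballP [e /= e0 eA].
have e20 : 0 < e / 2 by rewrite divr_gt0.
apply: filterS (r_near _ e20) => K nK.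
have leK : ((1 - e / 2)%:E <= limf_einf (fun x => (r K x)%:E) (pinfty_nbhs R))%E.
  rewrite limf_einfE; apply: ereal_sup_ge.
  exists (ereal_inf [set (r K x)%:E | x in [set x | 1 - e / 2 <= r K x]]).
    by exists [set x | 1 - e / 2 <= r K x].
  by apply/ereal_infP => _ [x rx <-]; rewrite lee_fin.
move: (le1 K) leK; rewrite /=; case: (limf_einf _ _) => // l.
rewrite !lee_fin => l1 el; apply: eA; rewrite /ball/= ltr_norml; lra.
Qed.

(** * Two jumps *)

Lemma le_measure_fin_bigcup d (T : measurableType d) (R : realType)
    (p : probability T R) (I : finType) (F : I -> set T) (c : R) :
    (forall i, measurable (F i)) -> (forall i, (p (F i) <= c%:E)%E) ->
  (p (\bigcup_i F i) <= (#|I|%:R * c)%:E)%E.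
Proof.
move=> mF Fc.
have bound (s : seq I) :
    (p (\big[setU/set0]_(i <- s) F i) <= ((size s)%:R * c)%:E)%E.
  elim: s => [|i s IH]; first by rewrite big_nil measure0 mul0r.
  rewrite big_cons /= -natr1 mulrDl mul1r addrC EFinD.
  apply: le_trans (measureU2 _ _ _) _ => //.
    exact: bigsetU_measurable.
  by apply: leeD; [exact: Fc|exact: IH].
rewrite cardE; apply: le_trans (bound (enum I)).
rewrite -bigcup_seq (_ : [set` enum I] = setT)//.
by apply/seteqP; split=> // i _ /=; rewrite mem_enum.
Qed.

Section events.
Context (R : realType) (n : nat).
Implicit Types (s : n.-tuple R) (x y L : R).

Definition sum_gt x : set (n.-tuple R) := [set s | x < \sum_(i < n) tnth s i].

Definition max_gt y : set (n.-tuple R) := [set s | exists i, y < tnth s i].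

Definition two_gt L : set (n.-tuple R) :=
  [set s | exists i j, [/\ i != j, L < tnth s i & L < tnth s j]].

Lemma measurable_tnth_gt (i : 'I_n) (x : R) :
  measurable [set s : n.-tuple R | x < tnth s i].
Proof.
have := measurable_tnth (T := R) i measurableT (measurable_itv `]x, +oo[).
by rewrite setTI set_itvoy.
Qed.

Lemma measurable_sum_gt x : measurable (sum_gt x).
Proof.
have msum : measurable_fun setT (fun s : n.-tuple R => \sum_(i < n) tnth s i).
  by apply: measurable_sum => i; exact: measurable_tnth.
have := msum measurableT _ (measurable_itv `]x, +oo[).
by rewrite setTI set_itvoy.
Qed.

Lemma measurable_max_gt y : measurable (max_gt y).
Proof.
rewrite (_ : max_gt y = \bigcup_i [set s | y < tnth s i]); last first.
  by apply/seteqP; split=> s /= [i]; [exists i|exists i].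
apply: fin_bigcup_measurable => [|i _]; first exact: finite_finset.
exact: measurable_tnth_gt.
Qed.

Lemma measurable_two_gt L : measurable (two_gt L).
Proof.
pose B (ij : 'I_n * 'I_n) : set (n.-tuple R) :=
  [set s | L < tnth s ij.1] `&` [set s | L < tnth s ij.2].
rewrite (_ : two_gt L = \bigcup_(ij in [set ij | ij.1 != ij.2]) B ij).
  apply: fin_bigcup_measurable => [|ij _]; first exact: finite_finset.
  by apply: measurableI; exact: measurable_tnth_gt.
apply/seteqP; split=> s /=.
  by move=> [i [j [ij Li Lj]]]; exists (i, j).
by move=> [[i j] /= ij [Li Lj]]; exists i, j.
Qed.

Lemma up_set_sum_gt x : up_set_tuple (sum_gt x).
Proof. by move=> s t st /lt_le_trans; apply; apply: ler_sum. Qed.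

Lemma up_set_two_gt L : up_set_tuple (two_gt L).
Proof.
move=> s t st [i [j [ij Li Lj]]]; exists i, j; split=> //.
  exact: lt_le_trans Li _.
exact: lt_le_trans Lj _.
Qed.

(** If at most one coordinate exceeds L, let i be that coordinate, or any one
    if there is none.  The others sum to at most n L <= K, and coordinate i
    is at most x - K, so the sum does not exceed x. *)
Lemma sum_gt_without_big_jump K L x : (0 < n)%N -> 0 <= L -> n%:R * L <= K ->
  sum_gt x `\` max_gt (x - K) `<=` two_gt L.
Proof.
move=> n0 L0 LK s [xs nomax]; apply: contrapT => notwo.
have [i iL] : exists i, forall j, j != i -> tnth s j <= L.
  have [[i Li]|noL] := pselect (exists i, L < tnth s i).
    exists i => j ji; rewrite leNgt; apply/negP => Lj.
    by apply: notwo; exists i, j; rewrite eq_sym.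
  exists (Ordinal n0) => j _; rewrite leNgt; apply/negP => Lj.
  by apply: noL; exists j.
have iK : tnth s i <= x - K.
  by rewrite leNgt; apply/negP => Ki; apply: nomax; exists i.
suff : \sum_(j < n) tnth s j <= x by rewrite leNgt xs.
rewrite (bigD1 i)//=.
have : \sum_(j < n | j != i) tnth s j <= \sum_(j < n | j != i) L.
  exact: ler_sum.
have : \sum_(j < n | j != i) L <= n%:R * L.
  have -> : n%:R * L = \sum_(j < n) L by rewrite sumr_const card_ord mulr_natl.
  rewrite [leRHS](bigD1 i)//=.
  by rewrite lerDr.
lra.
Qed.

End events.

Lemma one_sub_le_ratio d (T : measurableType d) (R : realType)
    (p : probability T R) (A B : set T) (e : R) :
    measurable A -> measurable B -> (0 < p B)%E ->
  (1 - e <= fine (p (A `&` B)) / fine (p B)) <->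
  (p (B `\` A) <= e%:E * p B)%E.
Proof.
move=> mA mB pB0.
have mAB : measurable (A `&` B) by exact: measurableI.
have mBA : measurable (B `\` A) by exact: measurableD.
have pBE : p B = (p (A `&` B) + p (B `\` A))%E.
  rewrite -measureU//; last first.
    by apply/seteqP; split=> // t /= [[At _] [_]].
  congr (p _); apply/seteqP; split=> t /=; last by case=> -[].
  by move=> Bt; have [At|At] := pselect (A t); [left|right].
have fB := fin_num_measure p _ mB.
have fAB := fin_num_measure p _ mAB.
have fBA := fin_num_measure p _ mBA.
have b0 : 0 < fine (p B) by rewrite fine_gt0// pB0 ltey_eq fB.
have bE : fine (p B) = fine (p (A `&` B)) + fine (p (B `\` A)).
  by rewrite pBE fineD.
rewrite -(fineK fBA) -(fineK fB) -EFinM lee_fin ler_pdivlMr//.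
split; nra.
Qed.

Lemma big_jump_ratioE d (T : measurableType d) (R : realType)
    (P : probability T R) (n : nat) (X : 'I_n -> {RV P >-> R}) (K x : R) :
  big_jump_ratio X K x =
    fine (distribution P (joint X) (max_gt (x - K) `&` sum_gt x)) /
    fine (distribution P (joint X) (sum_gt x)).
Proof.
rewrite /big_jump_ratio /distribution /pushforward.
have sumE t : \sum_(i < n) tnth (joint X t) i = \sum_(i < n) X i t.
  by apply: eq_bigr => i _; rewrite tnth_mktuple.
congr (fine (P _) / fine (P _)); apply/seteqP; split=> t /=;
  rewrite /sum_gt /max_gt/= sumE//.
- move=> [/bigmax_gtP[|[i _]]]; first by rewrite ltNge leNye.
  by rewrite lte_fin => xi ?; split=> //; exists i; rewrite tnth_mktuple.
- move=> [[i]]; rewrite tnth_mktuple => xi ?; split=> //.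
  by apply/bigmax_gtP; right; exists i => //; rewrite lte_fin.
Qed.

Lemma big_jump_ratio_le1 d (T : measurableType d) (R : realType)
    (P : probability T R) (n : nat) (X : 'I_n -> {RV P >-> R}) (K x : R) :
  big_jump_ratio X K x <= 1.
Proof.
rewrite big_jump_ratioE; set p := distribution P (joint X).
have mS := @measurable_sum_gt R n x.
have mMS : measurable (max_gt (x - K) `&` sum_gt x : set (n.-tuple R)).
  by apply: measurableI => //; exact: measurable_max_gt.
have le_p : fine (p (max_gt (x - K) `&` sum_gt x)) <= fine (p (sum_gt x)).
  rewrite fine_le// ?fin_num_measure//.
  by apply: le_measure; rewrite ?inE// => s [].
have [->|p0] := eqVneq (fine (p (sum_gt x))) 0; first by rewrite invr0 mulr0.
rewrite ler_pdivrMr ?mul1r// lt_neqAle eq_sym p0.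
by rewrite fine_ge0// measure_ge0.
Qed.

Section two_jumps.
Context d (T : measurableType d) (R : realType) (P : probability T R) (n : nat).
Context (X : 'I_n -> {RV P >-> R}) (F : R -> R) (iidX : iid_with_cdf X F).
Local Notation law := (distribution P (joint X)).

Lemma prob_pair_gt (i j : 'I_n) (x y : R) : i != j ->
  law [set s | x < tnth s i /\ y < tnth s j] = (tail F x * tail F y)%:E.
Proof.
move=> ij; have [indX cdfX] := iidX.
pose A k : set R := if k == i then `]x, +oo[%classic else `]y, +oo[%classic.
have mA k : measurable (A k) by rewrite /A; case: ifP => _; exact: measurable_itv.
have := indX [set i; j]%SET A mA.
rewrite big_setU1 ?inE//= big_set1 /A eqxx eq_sym (negbTE ij) EFinM.
rewrite -(prob_gt_tail x (cdfX i)) -(prob_gt_tail y (cdfX j)).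
rewrite !set_itvoy => <-; rewrite /distribution /pushforward; congr (P _).
apply/seteqP; split=> t /=; rewrite !tnth_mktuple.
  move=> [xi yj] k /=; rewrite !inE => /orP[]/eqP->; first by rewrite eqxx.
  by rewrite eq_sym (negbTE ij).
move=> Xt; split; first by have := Xt i; rewrite /= !inE eqxx; exact.
by have := Xt j; rewrite /= !inE eqxx orbT eq_sym (negbTE ij); exact.
Qed.

(** This lower bound is what turns tail (x - K) into a multiple of the
    probability that the sum exceeds x. *)
Lemma sum_gt_ge_pair (x y : R) : (2 <= n)%N -> (forall i t, 0 <= X i t) ->
  ((tail F x * tail F y)%:E <= law (sum_gt (x + y)))%E.
Proof.
move=> n2 X0.
pose i := Ordinal (ltnW n2); pose j := Ordinal n2.
rewrite -(@prob_pair_gt i j)//.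
have mjoint (A : set (n.-tuple R)) : measurable A -> measurable (joint X @^-1` A).
  by move=> mA; rewrite -[Z in measurable Z]setTI; exact: measurable_funPT.
rewrite /distribution /pushforward; apply: le_measure; rewrite ?inE.
- by apply/mjoint/measurableI; exact: measurable_tnth_gt.
- by apply: mjoint; exact: measurable_sum_gt.
move=> t /= [xi yj]; rewrite /sum_gt/= (bigD1 i)//= (bigD1 j)//=.
rewrite addrA; apply: (lt_le_trans (ltrD xi yj)); rewrite lerDl.
by apply: sumr_ge0 => k _; rewrite tnth_mktuple.
Qed.

(** The threshold K of the jump is fixed before L.  Two jumps above L come
    either without a jump above x - K, which has probability at most
    (e / 2) P(S_n > x), or with a jump above x - K at one index and one above
    L at another.  The latter has probability at most
    n^2 tail (x - K) tail L <= n^2 (tail L / tail K) P(S_n > x), which is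
    small when L is large. *)
Lemma two_jumps_negligible : (2 <= n)%N -> unbounded_cdf F ->
    (forall i t, 0 <= X i t) ->
    (forall e, 0 < e ->
      \forall K \near +oo, \forall x \near +oo, 1 - e <= big_jump_ratio X K x) ->
  forall e, 0 < e -> exists2 L, 0 <= L & \forall x \near +oo,
    (law (sum_gt x `&` two_gt L) <= e%:E * law (sum_gt x))%E.
Proof.
move=> n2 uF X0 XJ e e0.
have F0 := tail_gt0 uF.
have e20 : 0 < e / 2 by rewrite divr_gt0.
have [K _ nK] := pinfty_ex_gt0 (XJ _ e20).
pose N := #|{: 'I_n * 'I_n}|%:R : R.
have N0 : 0 < N.
  by rewrite ltr0n card_prod card_ord muln_gt0 !(ltnW n2).
have small : 0 < e / 2 * tail F K / N by rewrite divr_gt0// mulr_gt0.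
have [L L0 FL] := pinfty_ex_gt0 (tail_small uF small).
exists L; first exact: ltW.
apply: filterS nK => x; rewrite big_jump_ratioE.
have ge_pair : ((tail F (x - K) * tail F K)%:E <= law (sum_gt x))%E.
  by rewrite -{2}(subrK K x); exact: sum_gt_ge_pair.
have sum0 : (0 < law (sum_gt x))%E.
  by apply: lt_le_trans ge_pair; rewrite lte_fin mulr_gt0.
move=> /one_sub_le_ratio => /(_ (measurable_max_gt _) (measurable_sum_gt _) sum0) noJ.
pose B (ij : 'I_n * 'I_n) : set (n.-tuple R) := if ij.1 != ij.2 then
  [set s | x - K < tnth s ij.1 /\ L < tnth s ij.2] else set0.
have mB ij : measurable (B ij).
  rewrite /B; case: ifP => // _; apply: measurableI; exact: measurable_tnth_gt.
have subB : sum_gt x `&` two_gt L `<=`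
    (sum_gt x `\` max_gt (x - K)) `|` \bigcup_ij B ij.
  move=> s [xs [i [j [ij Li Lj]]]].
  have [[k Kk]|nomax] := pselect (max_gt (x - K) s); last by left.
  (* Of the two indices i and j, at least one differs from the index k of the
     jump above x - K. *)
  right; have [ki|ki] := eqVneq k i.
    by exists (k, j) => //; rewrite /B ki ij/= -ki.
  by exists (k, i) => //; rewrite /B ki/=.
have mBU : measurable (\bigcup_ij B ij).
  by apply: fin_bigcup_measurable => //; exact: finite_finset.
have mS : measurable (sum_gt x `\` max_gt (x - K) : set (n.-tuple R)).
  by apply: measurableD; [exact: measurable_sum_gt|exact: measurable_max_gt].
apply: (@le_trans _ _ (law (sum_gt x `\` max_gt (x - K)) + law (\bigcup_ij B ij))%E).
  apply: le_trans (measureU2 _ mS mBU).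
  apply: le_measure; rewrite ?inE//; last exact: measurableU.
  by apply: measurableI; [exact: measurable_sum_gt|exact: measurable_two_gt].
have lawB ij : (law (B ij) <= (tail F (x - K) * tail F L)%:E)%E.
  rewrite /B; case: ifP => ij12; first by rewrite prob_pair_gt.
  by rewrite measure0 lee_fin mulr_ge0// ltW.
have lawBU : (law (\bigcup_ij B ij) <= (e / 2)%:E * law (sum_gt x))%E.
  apply: le_trans (le_measure_fin_bigcup mB lawB) _.
  apply: (@le_trans _ _ ((e / 2)%:E * (tail F (x - K) * tail F K)%:E)%E); last first.
    by apply: lee_wpmul2l => //; rewrite lee_fin ltW.
  rewrite -EFinM lee_fin -/N.
  move: FL; rewrite ler_pdivlMr// => FL.
  have := F0 (x - K); nra.
have -> : (e%:E = (e / 2)%:E + (e / 2)%:E)%E by rewrite -EFinD -splitr.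
have h0 : (0 <= (e / 2)%:E)%E by rewrite lee_fin ltW.
rewrite ge0_muleDl//.
by apply: leeD; [exact: noJ|exact: lawBU].
Qed.

End two_jumps.

Theorem proposition8 (R : realType) (F G : R -> R)
    (F_unbounded : unbounded_cdf F) (G_unbounded : unbounded_cdf G)
    (F_J : classJ F) (FG : asymp (tail F) (tail G)) :
  classJ G.
Proof.
split=> // n n2 d T Q Y iidY.
have n0 : (0 < n)%N := ltnW n2.
have [d' [T' [P [X [iidX X0]]]]] := iid_family_exists n F_unbounded.
have [C C1 tailC] := asymp_dominated F_unbounded G_unbounded FG.
have XJ := F_J.2 n n2 _ _ _ X iidX.
move/cvg_limf_einf_1 : XJ => /(_ (big_jump_ratio_le1 X)) XJ.
apply/cvg_limf_einf_1; first exact: big_jump_ratio_le1.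
move=> e e0.
have C0 : 0 < C ^+ n by rewrite exprn_gt0// (lt_le_trans ltr01).
(* One factor C ^+ n pays for the two-jump event, the other one for the sum. *)
have eC0 : 0 < e / (C ^+ n * C ^+ n) by rewrite divr_gt0// mulr_gt0.
have [L L0 twoL] := two_jumps_negligible iidX n2 F_unbounded X0 XJ eC0.
have domYX : forall A, measurable A -> up_set_tuple A ->
    (distribution Q (joint Y) A <= (C ^+ n)%:E * distribution P (joint X) A)%E.
  apply: independent_dominated iidX.1 iidY.1 C1 _ => i x.
  rewrite (prob_gt_tail _ (iidX.2 i)) (prob_gt_tail _ (iidY.2 i)) -EFinM lee_fin.
  by have [] := tailC x.
have domXY : forall A, measurable A -> up_set_tuple A ->
    (distribution P (joint X) A <= (C ^+ n)%:E * distribution Q (joint Y) A)%E.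
  apply: independent_dominated iidY.1 iidX.1 C1 _ => i x.
  rewrite (prob_gt_tail _ (iidX.2 i)) (prob_gt_tail _ (iidY.2 i)) -EFinM lee_fin.
  by have [] := tailC x.
apply: filterS (nbhs_pinfty_ge (num_real (n%:R * L))) => K LK.
apply: filterS twoL => x twoX.
have msum := @measurable_sum_gt R n x.
have m2 : measurable (sum_gt x `&` two_gt L : set (n.-tuple R)).
  by apply: measurableI => //; exact: measurable_two_gt.
have sumX := domXY _ msum (@up_set_sum_gt R n x).
have sumY0 : (0 < distribution Q (joint Y) (sum_gt x))%E.
  have X0x : (0 < distribution P (joint X) (sum_gt x))%E.
    apply: (@lt_le_trans _ _ (tail F x * tail F 0)%:E).
      by rewrite lte_fin mulr_gt0// tail_gt0.
    by rewrite -{2}[x]addr0; exact: sum_gt_ge_pair.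
  rewrite lt0e measure_ge0 andbT; apply/eqP => Y0.
  by move: sumX; rewrite Y0 mule0 leNgt X0x.
rewrite big_jump_ratioE; apply/one_sub_le_ratio => //; first exact: measurable_max_gt.
have up2 : up_set_tuple (sum_gt x `&` two_gt L : set (n.-tuple R)).
  move=> s t st [xs Ls]; split; first exact: up_set_sum_gt xs.
  exact: up_set_two_gt Ls.
apply: (@le_trans _ _ (distribution Q (joint Y) (sum_gt x `&` two_gt L))).
  apply: le_measure; rewrite ?inE//.
    by apply: measurableD => //; exact: measurable_max_gt.
  move=> s sK; split; first by case: sK.
  exact: sum_gt_without_big_jump sK.
apply: le_trans (domYX _ m2 up2) _.
have Cn0 : (0 <= (C ^+ n)%:E)%E by rewrite lee_fin ltW.
apply: (@le_trans _ _ ((C ^+ n)%:E * ((e / (C ^+ n * C ^+ n))%:E *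
   ((C ^+ n)%:E * distribution Q (joint Y) (sum_gt x))))%E).
  apply: lee_wpmul2l => //; apply: le_trans twoX _; apply: lee_wpmul2l => //.
  by rewrite lee_fin ltW.
rewrite !muleA -!EFinM (_ : C ^+ n * _ * _ = e)//.
by field; rewrite gt_eqF.
Qed.
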